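(* Let $n\ge 2$, let $P=(p_1,\dots,p_n),\,Q=(q_1,\dots,q_n)\in\Gamma_n$, and let $r,R$ be real numbers with $0<r<1<R<\infty$ and $r\le \frac{p_i}{q_i}\le R$ for all $i\in\{1,\dots,n\}$. Let $s\in\mathbb{R}$ with $s\ge-1$. Then $$\left|\Omega_s(P\|Q)-\tfrac12E_{\Omega_s}(P\|Q)\right|\le\min\left\{\tfrac18\delta_{\Omega_s}(r,R)\,\chi^2(P\|Q),\ \tfrac1{12}\|\psi_s'''\|_\infty\,|\chi|^3(P\|Q),\ \left[\psi_s'(R)-\psi_s'(r)\right]V(P\|Q)\right\}$$ $$\le\min\left\{\frac{(R-r)^2}{32}\delta_{\Omega_s}(r,R),\ \frac{(R-r)^3}{96}\|\psi_s'''\|_\infty,\ \frac{R-r}{2}\left[\psi_s'(R)-\psi_s'(r)\right]\right\}$$ and $$\left|\Omega_s(P\|Q)-E^*_{\Omega_s}(P\|Q)\right|\le\min\left\{\tfrac18\delta_{\Omega_s}(r,R)\,\chi^2(P\|Q),\ \tfrac1{24}\|\psi_s'''\|_\infty\,|\chi|^3(P\|Q),\ \tfrac12\left[\psi_s'(R)-\psi_s'(r)\right]V(P\|Q)\right\}$$ $$\le\min\left\{\frac{(R-r)^2}{32}\delta_{\Omega_s}(r,R),\ \frac{(R-r)^3}{192}\|\psi_s'''\|_\infty,\ \frac{R-r}{4}\left[\psi_s'(R)-\psi_s'(r)\right]\right\},$$ where $$E^*_{\Omega_s}(P\|Q)=\begin{cases}\dfrac{1}{s(s-1)}\displaystyle\sum_{i=1}^n(p_i-q_i)\left(\frac{p_i+3q_i}{2(p_i+q_i)}\right)^s\left(\frac{p_i+(3-2s)q_i}{p_i+3q_i}\right),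 & s\ne0,1,\\ \displaystyle\sum_{i=1}^n(q_i-p_i)\ln\left(\frac{p_i+3q_i}{2(p_i+q_i)}\right)-\frac12\sum_{i=1}^n\frac{(p_i-q_i)^2}{p_i+3q_i}, & s=0,\\ \displaystyle\frac12\Delta(P\|Q)+\frac12\sum_{i=1}^n(p_i-q_i)\ln\left(\frac{p_i+3q_i}{2(p_i+q_i)}\right), & s=1,\end{cases}$$ $$\delta_{\Omega_s}(r,R)=\frac14\left[\frac1{r^3}\left(\frac{r+1}{2r}\right)^{s-2}-\frac1{R^3}\left(\frac{R+1}{2R}\right)^{s-2}\right],$$ and $\|\psi_s'''\|_\infty=\operatorname{ess\,sup}_{x\in[r,R]}|\psi_s'''(x)|$ is given by $$\|\psi_s'''\|_\infty=\frac{s+1+3r}{r^2(r+1)^3}\left(\frac{r+1}{2r}\right)^s.$$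
   Context: $\Gamma_n=\{(p_1,\dots,p_n): p_i>0,\ \sum_{i=1}^n p_i=1\}$, $n\ge 2$. For $P,Q\in\Gamma_n$ and $s\in\mathbb{R}$, $$\Omega_s(P\|Q)=\begin{cases}\dfrac{1}{s(s-1)}\left[\displaystyle\sum_{i=1}^n p_i\left(\frac{p_i+q_i}{2p_i}\right)^s-1\right], & s\ne0,1,\\ \displaystyle\sum_{i=1}^n p_i\ln\left(\frac{2p_i}{p_i+q_i}\right), & s=0,\\ \displaystyle\sum_{i=1}^n\left(\frac{p_i+q_i}{2}\right)\ln\left(\frac{p_i+q_i}{2p_i}\right), & s=1.\end{cases}$$ For $x>0$, $$\psi_s(x)=\begin{cases}\dfrac{1}{s(s-1)}\left[x\left(\frac{x+1}{2x}\right)^s-x-s\left(\frac{1-x}{2}\right)\right], & s\ne0,1,\\ \frac{1-x}{2}-x\ln\left(\frac{x+1}{2x}\right), & s=0,\\ \frac{x-1}{2}+\left(\frac{x+1}{2}\right)\ln\left(\frac{x+1}{2x}\right), & s=1,\end{cases}$$ and $\psi_s',\psi_s'''$ denote its first and third derivatives in $x$. $$E_{\Omega_s}(P\|Q)=\begin{cases}\dfrac{1}{s(s-1)}\displaystyle\sum_{i=1}^n\left(\frac{p_i-q_i}{p_i+q_i}\right)\left(\frac{p_i+q_i}{2p_i}\right)^s\left[p_i+(1-s)q_i\right], & s\ne 0,1,\\ D(Q\|P)-\frac12\Delta(P\|Q), & s=0,\\ \frac12\left[\chi^2(Q\|P)-D(Q\|P)\right], & s=1.\end{cases}$$ Here $\chi^2(P\|Q)=\sum_{i=1}^n\frac{(p_i-q_i)^2}{q_i}$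 (so $\chi^2(Q\|P)=\sum_i\frac{(p_i-q_i)^2}{p_i}$); $|\chi|^3(P\|Q)=\sum_{i=1}^n\frac{|p_i-q_i|^3}{q_i^2}$; $V(P\|Q)=\sum_{i=1}^n|p_i-q_i|$; $\Delta(P\|Q)=\sum_{i=1}^n\frac{(p_i-q_i)^2}{p_i+q_i}$; $D(Q\|P)=\sum_{i=1}^n(q_i-p_i)\ln\left(\frac{p_i+q_i}{2p_i}\right)$. *)

(* Defs.v *)
From HB Require Import structures.
From mathcomp Require Import all_boot all_order all_algebra.
From mathcomp Require Import all_classical all_reals all_analysis.
From mathcomp Require Import ess_sup_inf.

Set Implicit Arguments.
Unset Strict Implicit.
Unset Printing Implicit Defensive.

Import Order.TTheory GRing.Theory Num.Theory.
Import numFieldNormedType.Exports.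

Local Open Scope classical_set_scope.
Local Open Scope ring_scope.

Definition Gamma (K : realType) (n : nat) : set ('I_n -> K) :=
  [set p | (forall i, 0 < p i) /\ \sum_(i < n) p i = 1].

Section divergences.
Variables (K : realType) (n : nat).
Implicit Types p q : 'I_n -> K.

Definition chi2 p q : K := \sum_(i < n) (p i - q i) ^+ 2 / q i.

Definition chi3 p q : K := \sum_(i < n) `|p i - q i| ^+ 3 / q i ^+ 2.

Definition Vdist p q : K := \sum_(i < n) `|p i - q i|.

Definition Delta p q : K := \sum_(i < n) (p i - q i) ^+ 2 / (p i + q i).

(* D(P||Q); exchanging the arguments gives
   D(Q||P) = \sum_i (q_i - p_i) ln ((p_i + q_i) / (2 p_i)). *)
Definition Ddiv p q : K :=
  \sum_(i < n) (p i - q i) * ln ((p i + q i) / (2 * q i)).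

Definition Omega (s : K) p q : K :=
  if s == 0 then \sum_(i < n) p i * ln (2 * p i / (p i + q i))
  else if s == 1 then
    \sum_(i < n) (p i + q i) / 2 * ln ((p i + q i) / (2 * p i))
  else
    (s * (s - 1))^-1 *
      (\sum_(i < n) p i * ((p i + q i) / (2 * p i)) `^ s - 1).

Definition E_Omega (s : K) p q : K :=
  if s == 0 then Ddiv q p - 2^-1 * Delta p q
  else if s == 1 then 2^-1 * (chi2 q p - Ddiv q p)
  else
    (s * (s - 1))^-1 *
      \sum_(i < n) (p i - q i) / (p i + q i) *
        ((p i + q i) / (2 * p i)) `^ s * (p i + (1 - s) * q i).

Definition Estar_Omega (s : K) p q : K :=
  if s == 0 then
    \sum_(i < n) (q i - p i) * ln ((p i + 3 * q i) / (2 * (p i + q i)))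
    - 2^-1 * \sum_(i < n) (p i - q i) ^+ 2 / (p i + 3 * q i)
  else if s == 1 then
    2^-1 * Delta p q
    + 2^-1 *
      \sum_(i < n) (p i - q i) * ln ((p i + 3 * q i) / (2 * (p i + q i)))
  else
    (s * (s - 1))^-1 *
      \sum_(i < n) (p i - q i) *
        ((p i + 3 * q i) / (2 * (p i + q i))) `^ s *
        ((p i + (3 - 2 * s) * q i) / (p i + 3 * q i)).

End divergences.

Section generating_function.
Variable K : realType.

(* Only the values at x > 0 are meaningful. *)
Definition psi (s x : K) : K :=
  if s == 0 then (1 - x) / 2 - x * ln ((x + 1) / (2 * x))
  else if s == 1 then
    (x - 1) / 2 + (x + 1) / 2 * ln ((x + 1) / (2 * x))
  else
    (s * (s - 1))^-1 *
      (x * ((x + 1) / (2 * x)) `^ s - x - s * ((1 - x) / 2)).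

Definition delta_Omega (s r R : K) : K :=
  4^-1 * ((r ^+ 3)^-1 * ((r + 1) / (2 * r)) `^ (s - 2)
          - (R ^+ 3)^-1 * ((R + 1) / (2 * R)) `^ (s - 2)).

(* The essential supremum of |psi_s'''| for the Lebesgue measure restricted
   to [r, R], as an extended real. *)
Definition psi3_esssup (s r R : K) : \bar K :=
  ess_sup (mrestr (@lebesgue_measure K) (measurable_itv `[r, R]))
    (fun x : K => `| (psi s)^`(3)%classic x |%:E).

(* The same as a real number; [fine] would send +oo to 0, so this is only
   meaningful where [psi3_esssup] is finite. *)
Definition psi3_norm (s r R : K) : K := fine (psi3_esssup s r R).

End generating_function.

Definition min3 (K : realType) (a b c : K) : K := Num.min a (Num.min b c).

(* Main.v *)
Require Import Defs.
From HB Require Import structures.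
From mathcomp Require Import all_boot all_order all_algebra.
From mathcomp Require Import all_classical all_reals all_analysis.
From mathcomp Require Import ess_sup_inf.
From mathcomp Require Import ring lra.

Set Implicit Arguments.
Unset Strict Implicit.
Unset Printing Implicit Defensive.

Import Order.TTheory GRing.Theory Num.Theory.
Import numFieldNormedType.Exports.

Local Open Scope classical_set_scope.
Local Open Scope ring_scope.

(** Let x_i = p_i / q_i. Up to multiples of the sum of the p_i - q_i, which
    vanishes, Omega_s is the sum of the q_i psi_s(x_i), E_Omega_s that of the
    (p_i - q_i) psi_s'(x_i), and E*_Omega_s that of the
    (p_i - q_i) psi_s'((1 + x_i) / 2). Since psi_s and psi_s' vanish at 1, the
    two differences to be bounded are averages, with weights q_i, of the errors
    made on psi_s(x_i) - psi_s(1) by the trapezoid rule and by the midpoint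
    rule for the integral of psi_s' between 1 and x_i.

    Both quadrature errors are odd in the half-length u of the interval
    centred at m: they are
      f(m + u) - f(m - u) - u (f'(m + u) + f'(m - u)) and
      f(m + u) - f(m - u) - 2 u f'(m).
    Differentiating them in u, once for the first and twice for the second,
    leaves the difference f''(m + u) - f''(m - u). A bound on it by a multiple
    of a power of u is then integrated by [norm_le_expn_derive]. The exponent 0
    with the oscillation of f'' gives the bound by delta and chi^2; the
    exponent 1 with a Lipschitz constant of f'' gives the one by the third
    derivative and |chi|^3. Monotonicity of f' alone gives the bound by V.

    What is specific to psi_s is the sign of its derivatives. One has
      psi_s'' = u^s / (x (x + 1)^2) and
      psi_s''' = - (s + 1 + 3 x) / (x^2 (x + 1)^3) u^s,
    where u = (x + 1) / (2 x). So psi_s' is nondecreasing. For s >= -1, psi_s''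
    is nonincreasing, so that its oscillation on [r, R] is
    psi_s''(r) - psi_s''(R), which is delta; and |psi_s'''| is a product of
    nonincreasing nonnegative factors ([psi3_nondecreasing]), so that its
    essential supremum is its value at r.

    Finally, chi^2, |chi|^3 and V are the averages of |x_i - 1|^k for
    k = 2, 3, 1. As the average of the x_i is 1, convexity bounds them by the
    value at 1 of the chord of |x - 1|^k over [r, R] ([moment_le_chord]), hence
    by (R - r)^2 / 4, (R - r)^3 / 8 and (R - r) / 2. *)

(** * Derivatives of functions given pointwise *)

Section pointwise_derivatives.
Context {K : realType}.
Implicit Types (f g : K -> K) (t a b c : K).

Lemma is_derive_cast f t a b : is_derive t 1 f a -> a = b -> is_derive t 1 f b.
Proof. by move=> + <-. Qed.

Lemma is_derive_cstf c t : is_derive t 1 (fun=> c) 0.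
Proof. exact: is_derive_cst. Qed.

Lemma is_derive_idf t : is_derive t 1 (fun x : K => x) 1.
Proof. exact: is_derive_id. Qed.

Lemma is_derive_addf f g t a b : is_derive t 1 f a -> is_derive t 1 g b ->
  is_derive t 1 (fun x => f x + g x) (a + b).
Proof. exact: is_deriveD. Qed.

Lemma is_derive_oppf f t a : is_derive t 1 f a ->
  is_derive t 1 (fun x => - f x) (- a).
Proof. exact: is_deriveN. Qed.

Lemma is_derive_mulf f g t a b : is_derive t 1 f a -> is_derive t 1 g b ->
  is_derive t 1 (fun x => f x * g x) (f t * b + g t * a).
Proof. by move=> fa gb; have := is_deriveM fa gb. Qed.

Lemma is_derive_expf f n t a : is_derive t 1 f a ->
  is_derive t 1 (fun x => f x ^+ n) (n%:R * f t ^+ n.-1 * a).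
Proof. by move=> fa; have := is_deriveX n fa; rewrite exprfctE. Qed.

Lemma is_derive_invf f t a : f t != 0 -> is_derive t 1 f a ->
  is_derive t 1 (fun x => (f x)^-1) (- a / f t ^+ 2).
Proof.
move=> ft0 [df <-]; apply: DeriveDef; first exact: derivableV.
by rewrite deriveV// scaleNr mulNr mulrC.
Qed.

Lemma is_derive_lnf f t a : 0 < f t -> is_derive t 1 f a ->
  is_derive t 1 (fun x => ln (f x)) (a / f t).
Proof.
by move=> ft0 fa; rewrite mulrC; apply: is_derive1_comp; exact: is_derive1_ln.
Qed.

Lemma is_derive_powf f s t a : 0 < f t -> is_derive t 1 f a ->
  is_derive t 1 (fun x => f x `^ s) (s * f t `^ s * a / f t).
Proof.
move=> ft0 fa; apply: (@is_derive_cast _ _ (s * f t `^ (s - 1) * a)).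
  by apply: (@is_derive1_comp _ (@powR _ ^~ s) f); exact: is_derive1_powR.
have -> : f t `^ (s - 1) = f t `^ s / f t.
  by rewrite powRB ?powRr1 ?ltW// (gt_eqF ft0) implybT.
by ring.
Qed.

End pointwise_derivatives.

Lemma is_derive_continuous {K : realType} (f : K -> K) (t a : K) :
  is_derive t 1 f a -> {for t, continuous f}.
Proof.
by move=> [df _]; exact/differentiable_continuous/derivable1_diffP.
Qed.

(** One rule of differentiation. The [eassumption] comes first, so that a
    derivative stated for a compound function is used before the rules for its
    subterms. Without [notypeclasses], each rule would start an instance search
    for the derivatives of the subterms. *)
Ltac derive_step :=
  first [ eassumption
    | notypeclasses refine (is_derive_cstf _ _)
    | notypeclasses refine (is_derive_idf _)
    | notypeclasses refine (is_derive_addf _ _)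
    | notypeclasses refine (is_derive_oppf _)
    | notypeclasses refine (is_derive_mulf _ _)
    | notypeclasses refine (is_derive_expf _ _)
    | notypeclasses refine (is_derive_invf _ _)
    | notypeclasses refine (is_derive_lnf _ _)
    | notypeclasses refine (is_derive_powf _ _ _) ].

(** Leaves the side conditions of the rules, then the equality between the
    derivative that they give and the announced one. *)
Ltac derive_rules :=
  notypeclasses refine (is_derive_cast _ _); [ repeat derive_step | rewrite /= ].

Lemma mean_value {K : realType} (f f' : K -> K) (a b : K) : a <= b ->
  (forall t : K, a <= t <= b -> is_derive t 1 f (f' t)) ->
  exists2 c, a <= c <= b & f b - f a = f' c * (b - a).
Proof.
move=> ab df; have [||c] := @MVT_segment _ f f' a b ab.
- move=> t; rewrite in_itv/= => /andP[at_ tb]; apply: df.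
  by rewrite !ltW.
- by apply: derivable_within_continuous => t; rewrite in_itv/= => /df[].
by rewrite in_itv/= => cab E; exists c.
Qed.

(** * Bounds on symmetric differences *)

(** Integration of a bound on the derivative, without integrals: both
    C t^(n+1) / (n+1) - H t and C t^(n+1) / (n+1) + H t have a nonnegative
    derivative. *)
Lemma norm_le_expn_derive {K : realType} (H h : K -> K) (C w : K) n : H 0 = 0 ->
  (forall t : K, 0 <= t <= w -> is_derive t 1 H (h t)) ->
  (forall t : K, 0 <= t <= w -> `|h t| <= C * t ^+ n) ->
  forall t : K, 0 <= t <= w -> `|H t| <= C / n.+1%:R * t ^+ n.+1.
Proof.
move=> H0 dH hC t /andP[t0 tw].
have key (e : K) : `|e| = 1 -> e * H t <= C / n.+1%:R * t ^+ n.+1.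
  move=> e1; pose G x := C / n.+1%:R * x ^+ n.+1 - e * H x.
  have dG x : 0 <= x <= w -> is_derive x 1 G (C * x ^+ n - e * h x).
    move=> xw; have dHx := dH _ xw.
    derive_rules.
    field.
    by apply: lt0r_neq0; have := ler0n K n; lra.
  have [|c /andP[c0 ct] Gt] := @mean_value _ G (fun x => C * x ^+ n - e * h x)
    0 t t0.
    by move=> x /andP[x0 xt]; apply: dG; rewrite x0 (le_trans xt).
  have: 0 <= G t - G 0.
    rewrite Gt subr0 mulr_ge0// subr_ge0 (le_trans (ler_norm _))//.
    by rewrite normrM e1 mul1r hC// c0 (le_trans ct).
  by rewrite /G H0 expr0n !mulr0 !subr0 subr_ge0.
rewrite ler_norml lerNl; apply/andP; split.
  by rewrite -mulN1r key// normrN1.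
by rewrite -[H t]mul1r key// normr1.
Qed.

Lemma is_derive_addl_arg {K : realType} (f : K -> K) (m u a : K) :
  is_derive (m + u) 1 f a -> is_derive u 1 (fun x => f (m + x)) a.
Proof.
move=> fa; rewrite -[a]mulr1; apply: (@is_derive1_comp _ f (fun x => m + x)).
by derive_rules; rewrite add0r.
Qed.

Lemma is_derive_subl_arg {K : realType} (f : K -> K) (m u a : K) :
  is_derive (m - u) 1 f a -> is_derive u 1 (fun x => f (m - x)) (- a).
Proof.
move=> fa; rewrite -mulrN1; apply: (@is_derive1_comp _ f (fun x => m - x)).
by derive_rules; rewrite add0r.
Qed.

Section symmetric_differences.
Context {K : realType}.
Variables (f f1 f2 : K -> K) (m w : K).
Hypothesis w0 : 0 <= w.
Hypothesis df : forall t, m - w <= t <= m + w -> is_derive t 1 f (f1 t).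

Let in_right (u : K) : 0 <= u <= w -> m - w <= m + u <= m + w.
Proof. by move=> ?; lra. Qed.

Let in_left (u : K) : 0 <= u <= w -> m - w <= m - u <= m + w.
Proof. by move=> ?; lra. Qed.

Let symD (g g1 : K -> K)
    (dg : forall t, m - w <= t <= m + w -> is_derive t 1 g (g1 t)) u :
  0 <= u <= w ->
  is_derive u 1 (fun x => g (m + x)) (g1 (m + u)) *
  is_derive u 1 (fun x => g (m - x)) (- g1 (m - u)).
Proof.
move=> uw; split; first exact/is_derive_addl_arg/dg/in_right.
exact/is_derive_subl_arg/dg/in_left.
Qed.

(** The approximations of f (m + w) - f (m - w) by c w that use f1 only. Here
    c is any number, so that the lemma serves for both quadrature rules. *)
Lemma symmetric_difference_bound (c D : K) :
  (forall u, 0 <= u <= w -> `|f1 (m + u) + f1 (m - u) - c| <= D) ->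
  `|f (m + w) - f (m - w) - c * w| <= D * w.
Proof.
move=> f1D.
rewrite -[D]divr1 -[w in leRHS]expr1 -[1]/(1%:R).
apply: (@norm_le_expn_derive _ (fun x => f (m + x) - f (m - x) - c * x)
  (fun x => f1 (m + x) + f1 (m - x) - c) _ w 0); last by rewrite w0 lexx.
- by rewrite addr0 subr0; ring.
- move=> u uw; have [dr dl] := symD df uw.
  derive_rules.
  by ring.
- by move=> u uw; rewrite expr0 mulr1 f1D.
Qed.

Hypothesis df1 : forall t, m - w <= t <= m + w -> is_derive t 1 f1 (f2 t).
Variables (C : K) (n : nat).
Hypothesis f2C :
  forall u, 0 <= u <= w -> `|f2 (m + u) - f2 (m - u)| <= C * u ^+ n.

(** The error vanishes at w = 0 together with its first derivative in w, and
    its second derivative is f2 (m + w) - f2 (m - w): the bound is integrated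
    twice. *)
Lemma midpoint_error :
  `|f (m + w) - f (m - w) - 2 * w * f1 m|
    <= C / n.+1%:R / n.+2%:R * w ^+ n.+2.
Proof.
apply: (@norm_le_expn_derive _ (fun x => f (m + x) - f (m - x) - 2 * x * f1 m)
  (fun x => f1 (m + x) + f1 (m - x) - 2 * f1 m) _ w); last by rewrite w0 lexx.
- by rewrite addr0 subr0; ring.
- move=> u uw; have [dr dl] := symD df uw.
  derive_rules.
  by ring.
apply: (@norm_le_expn_derive _ _ (fun x => f2 (m + x) - f2 (m - x))) => //.
- by rewrite addr0 subr0; ring.
- move=> u uw; have [dr dl] := symD df1 uw.
  derive_rules.
  by ring.
Qed.

(** The derivative of the error in w is - w (f2 (m + w) - f2 (m - w)): the f1
    terms cancel, and one integration is enough. *)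
Lemma trapezoid_error :
  `|f (m + w) - f (m - w) - w * (f1 (m + w) + f1 (m - w))|
    <= C / n.+2%:R * w ^+ n.+2.
Proof.
apply: (@norm_le_expn_derive _
  (fun x => f (m + x) - f (m - x) - x * (f1 (m + x) + f1 (m - x)))
  (fun x => - (x * (f2 (m + x) - f2 (m - x)))) _ w); last by rewrite w0 lexx.
- by rewrite addr0 subr0; ring.
- move=> u uw; have [dr dl] := symD df uw; have [dr1 dl1] := symD df1 uw.
  derive_rules.
  by ring.
move=> u uw; have /andP[u0 _] := uw.
by rewrite normrN normrM ger0_norm// exprS mulrCA ler_wpM2l// f2C.
Qed.

End symmetric_differences.

(** * Midpoint and trapezoid rules *)

Section quadrature_rules.
Context {K : realType}.
Variables (f f1 : K -> K) (r R : K).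
Hypothesis df : forall t, r <= t <= R -> is_derive t 1 f (f1 t).

Let mid_right (a b : K) : (a + b) / 2 + (b - a) / 2 = b.
Proof. by field. Qed.

Let mid_left (a b : K) : (a + b) / 2 - (b - a) / 2 = a.
Proof. by field. Qed.

Section nondecreasing_derivative.
Hypothesis f1_ndecr : forall u v, r <= u -> u <= v -> v <= R -> f1 u <= f1 v.

(* The common part of the two rules: c is the value of f1, or the mean of two
   values of f1, by which the rule replaces f1 on [a, b]. *)
Let sum_bound (a b c : K) : r <= a -> a <= b -> b <= R ->
  (forall u v, a <= u -> u <= (a + b) / 2 -> v = a + b - u ->
     `|f1 v + f1 u - 2 * c| <= f1 R - f1 r) ->
  `|f b - f a - (b - a) * c| <= 2^-1 * (f1 R - f1 r) * `|b - a|.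
Proof.
move=> ra ab bR f1c.
have ab' : 0 <= b - a by lra.
have ba0 : 0 <= (b - a) / 2 by lra.
have := @symmetric_difference_bound K f f1 ((a + b) / 2) ((b - a) / 2) ba0 _
  (2 * c) (f1 R - f1 r).
rewrite (ger0_norm ab') mid_right mid_left.
rewrite (_ : 2 * c * ((b - a) / 2) = (b - a) * c); last by field.
rewrite (_ : 2^-1 * _ * (b - a) = (f1 R - f1 r) * ((b - a) / 2)); last by ring.
apply.
- by move=> t tab; apply: df; lra.
- by move=> u uab; apply: f1c; lra.
Qed.

Lemma midpoint_rule_ndecr a b : r <= a <= R -> r <= b <= R ->
  `|f b - f a - (b - a) * f1 ((a + b) / 2)|
    <= 2^-1 * (f1 R - f1 r) * `|b - a|.
Proof.
wlog ab : a b / a <= b => [wl|] ra rb.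
  have /orP[|ba] := le_total a b; first by move=> ab; apply: wl.
  rewrite -normrN distrC [a + b]addrC.
  rewrite (_ : - (f b - f a - _) = f a - f b - (a - b) * f1 ((b + a) / 2));
    last by ring.
  exact: wl.
apply: sum_bound => [|||u v ua um ->]; [lra..|].
have h1 : f1 r <= f1 u by apply: f1_ndecr; lra.
have h2 : f1 u <= f1 ((a + b) / 2) by apply: f1_ndecr; lra.
have h3 : f1 ((a + b) / 2) <= f1 (a + b - u) by apply: f1_ndecr; lra.
have h4 : f1 (a + b - u) <= f1 R by apply: f1_ndecr; lra.
by rewrite ler_norml; lra.
Qed.

Lemma trapezoid_rule_ndecr a b : r <= a <= R -> r <= b <= R ->
  `|f b - f a - (b - a) * ((f1 a + f1 b) / 2)|
    <= 2^-1 * (f1 R - f1 r) * `|b - a|.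
Proof.
wlog ab : a b / a <= b => [wl|] ra rb.
  have /orP[|ba] := le_total a b; first by move=> ab; apply: wl.
  rewrite -normrN distrC.
  rewrite (_ : - (f b - f a - _) = f a - f b - (a - b) * ((f1 b + f1 a) / 2));
    last by ring.
  exact: wl.
apply: sum_bound => [|||u v ua um ->]; [lra..|].
have h1 : f1 r <= f1 a by apply: f1_ndecr; lra.
have h2 : f1 a <= f1 u by apply: f1_ndecr; lra.
have h3 : f1 u <= f1 (a + b - u) by apply: f1_ndecr; lra.
have h4 : f1 (a + b - u) <= f1 b by apply: f1_ndecr; lra.
have h5 : f1 b <= f1 R by apply: f1_ndecr; lra.
by rewrite ler_norml; lra.
Qed.

End nondecreasing_derivative.

Section second_derivative.
Variables (f2 : K -> K) (C : K) (n : nat).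
Hypothesis df1 : forall t, r <= t <= R -> is_derive t 1 f1 (f2 t).
(** Taking n = 0 for a bounded oscillation and n = 1 for a Lipschitz function
    treats both cases at once. *)
Hypothesis f2C : forall u v, r <= u -> u <= v -> v <= R ->
  `|f2 v - f2 u| <= C * (v - u) ^+ n.

(* The points m + u and m - u are at distance 2 u, whence the factor 2^n; it
   meets the power of the half-length in half_expn. *)
Let f2_sym (a b u : K) : r <= a -> b <= R -> 0 <= u <= (b - a) / 2 ->
  `|f2 ((a + b) / 2 + u) - f2 ((a + b) / 2 - u)| <= C * 2 ^+ n * u ^+ n.
Proof.
move=> ra bR uab; rewrite -mulrA -exprMn.
rewrite (_ : 2 * u = (a + b) / 2 + u - ((a + b) / 2 - u)); last by ring.
by apply: f2C; lra.
Qed.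

Let half_expn (w : K) : 2 ^+ n * (w / 2) ^+ n.+2 = w ^+ n.+2 / 4.
Proof.
rewrite expr_div_n -[n.+2]addn2 !exprD; field.
by rewrite expf_neq0.
Qed.

Lemma midpoint_rule a b : r <= a <= R -> r <= b <= R ->
  `|f b - f a - (b - a) * f1 ((a + b) / 2)|
    <= C / (4 * n.+1%:R * n.+2%:R) * `|b - a| ^+ n.+2.
Proof.
wlog ab : a b / a <= b => [wl|] ra rb.
  have /orP[|ba] := le_total a b; first by move=> ab; apply: wl.
  rewrite -normrN distrC [a + b]addrC.
  rewrite (_ : - (f b - f a - _) = f a - f b - (a - b) * f1 ((b + a) / 2));
    last by ring.
  exact: wl.
have ab' : 0 <= b - a by lra.
have ba0 : 0 <= (b - a) / 2 by lra.
have := @midpoint_error K f f1 f2 ((a + b) / 2) ((b - a) / 2) ba0 _ _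
  (C * 2 ^+ n) n.
rewrite (ger0_norm ab') mid_right mid_left.
rewrite (_ : 2 * ((b - a) / 2) = b - a); last by field.
rewrite (_ : C * 2 ^+ n / _ / _ * _ =
  C / n.+1%:R / n.+2%:R * (2 ^+ n * ((b - a) / 2) ^+ n.+2)); last by ring.
rewrite half_expn (_ : C / (4 * _ * _) * _ =
  C / n.+1%:R / n.+2%:R * ((b - a) ^+ n.+2 / 4)); last first.
  by rewrite !invfM; ring.
apply.
- by move=> t tab; apply: df; lra.
- by move=> t tab; apply: df1; lra.
- by move=> u uab; apply: f2_sym => //; lra.
Qed.

Lemma trapezoid_rule a b : r <= a <= R -> r <= b <= R ->
  `|f b - f a - (b - a) * ((f1 a + f1 b) / 2)|
    <= C / (4 * n.+2%:R) * `|b - a| ^+ n.+2.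
Proof.
wlog ab : a b / a <= b => [wl|] ra rb.
  have /orP[|ba] := le_total a b; first by move=> ab; apply: wl.
  rewrite -normrN distrC.
  rewrite (_ : - (f b - f a - _) = f a - f b - (a - b) * ((f1 b + f1 a) / 2));
    last by ring.
  exact: wl.
have ab' : 0 <= b - a by lra.
have ba0 : 0 <= (b - a) / 2 by lra.
have := @trapezoid_error K f f1 f2 ((a + b) / 2) ((b - a) / 2) ba0 _ _
  (C * 2 ^+ n) n.
rewrite (ger0_norm ab') mid_right mid_left.
rewrite (_ : (b - a) / 2 * _ = (b - a) * ((f1 a + f1 b) / 2)); last by ring.
rewrite (_ : C * 2 ^+ n / _ * _ =
  C / n.+2%:R * (2 ^+ n * ((b - a) / 2) ^+ n.+2)); last by ring.
rewrite half_expn (_ : C / (4 * _) * _ =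
  C / n.+2%:R * ((b - a) ^+ n.+2 / 4)); last first.
  by rewrite !invfM; ring.
apply.
- by move=> t tab; apply: df; lra.
- by move=> t tab; apply: df1; lra.
- by move=> u uab; apply: f2_sym => //; lra.
Qed.

End second_derivative.
End quadrature_rules.

(** * Derivatives of the generating function *)

Section psi_derivatives.
Context {K : realType}.
Implicit Types s x : K.

(** At x = p / q this is the ratio of the mean (p + q) / 2 to p. *)
Definition mean_ratio x : K := (x + 1) / (2 * x).

(** The three derivatives of psi s on the positive reals. They keep the exponent
    s, instead of s - 1, s - 2, s - 3: the power of mean_ratio is then a single
    atom for algebra. From the second derivative on, the three cases of psi
    have the same formula. *)
Definition psi1 s x : K :=
  if s == 0 then (x + 1)^-1 - 2^-1 - ln (mean_ratio x)
  else if s == 1 then 2^-1 * (1 + ln (mean_ratio x) - x^-1)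
  else (s * (s - 1))^-1 *
    (mean_ratio x `^ s * ((x + 1 - s) / (x + 1)) - 1 + s / 2).

Definition psi2 s x : K := mean_ratio x `^ s / (x * (x + 1) ^+ 2).

Definition psi3 s x : K :=
  - ((s + 1 + 3 * x) / (x ^+ 2 * (x + 1) ^+ 3) * mean_ratio x `^ s).

Lemma mean_ratio_gt0 x : 0 < x -> 0 < mean_ratio x.
Proof. by move=> x0; rewrite /mean_ratio divr_gt0//; lra. Qed.

Lemma is_derive_mean_ratio x : 0 < x ->
  is_derive x 1 mean_ratio (- (2 * x ^+ 2)^-1).
Proof.
move=> x0; rewrite /mean_ratio; derive_rules.
  by rewrite mulf_neq0// gt_eqF.
by field; rewrite gt_eqF.
Qed.

Lemma is_derive_ln_mean_ratio x : 0 < x ->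
  is_derive x 1 (fun x => ln (mean_ratio x)) (- (x * (x + 1))^-1).
Proof.
move=> x0; have dS := is_derive_mean_ratio x0; have S0 := mean_ratio_gt0 x0.
derive_rules.
rewrite /mean_ratio; field.
by rewrite !gt_eqF//; lra.
Qed.

Lemma is_derive_powR_mean_ratio s x : 0 < x ->
  is_derive x 1 (fun x => mean_ratio x `^ s)
    (- (s / (x * (x + 1)) * mean_ratio x `^ s)).
Proof.
move=> x0; have dS := is_derive_mean_ratio x0; have S0 := mean_ratio_gt0 x0.
derive_rules.
move: (mean_ratio x `^ s) => y; rewrite /mean_ratio; field.
by rewrite !gt_eqF//; lra.
Qed.

Lemma is_derive_psi s x : 0 < x -> is_derive x 1 (psi s) (psi1 s x).
Proof.
move=> x0; have dS := is_derive_powR_mean_ratio s x0.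
have dl := is_derive_ln_mean_ratio x0.
have x1 : x + 1 != 0 by rewrite gt_eqF//; lra.
rewrite (_ : psi s = fun x =>
  if s == 0 then (1 - x) / 2 - x * ln (mean_ratio x)
  else if s == 1 then (x - 1) / 2 + (x + 1) / 2 * ln (mean_ratio x)
  else (s * (s - 1))^-1 *
      (x * mean_ratio x `^ s - x - s * ((1 - x) / 2)))//.
rewrite /psi1; case: eqVneq => [_|s0]; last case: eqVneq => [_|s1].
- by derive_rules; field; rewrite x1 gt_eqF.
- by derive_rules; field; rewrite x1 gt_eqF.
- derive_rules.
  move: (mean_ratio x `^ s) => y; field.
  by rewrite x1 s0 subr_eq0 s1 gt_eqF.
Qed.

Lemma is_derive_psi1 s x : 0 < x -> is_derive x 1 (psi1 s) (psi2 s x).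
Proof.
move=> x0; have dS := is_derive_powR_mean_ratio s x0.
have dl := is_derive_ln_mean_ratio x0.
have x1 : x + 1 != 0 by rewrite gt_eqF//; lra.
have xn0 : x != 0 by rewrite gt_eqF.
rewrite /psi1 /psi2; case: eqVneq => [->|s0]; last case: eqVneq => [->|s1].
- by derive_rules => //; rewrite powRr0; field; rewrite x1.
- derive_rules => //; rewrite powRr1 ?ltW ?mean_ratio_gt0// /mean_ratio.
  by field; rewrite x1.
- derive_rules => //.
  move: (mean_ratio x `^ s) => y; field.
  by rewrite x1 xn0 s0 subr_eq0 s1.
Qed.

Lemma is_derive_psi2 s x : 0 < x -> is_derive x 1 (psi2 s) (psi3 s x).
Proof.
move=> x0; have dS := is_derive_powR_mean_ratio s x0.
have x1 : x + 1 != 0 by rewrite gt_eqF//; lra.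
have xn0 : x != 0 by rewrite gt_eqF.
rewrite /psi2 /psi3; derive_rules.
  by rewrite mulf_neq0// expf_neq0.
by move: (mean_ratio x `^ s) => y; field; rewrite x1.
Qed.

Lemma continuous_psi3 s x : 0 < x -> {for x, continuous (psi3 s)}.
Proof.
move=> x0; have dS := is_derive_powR_mean_ratio s x0.
have x1 : x + 1 != 0 by rewrite gt_eqF//; lra.
have xn0 : x != 0 by rewrite gt_eqF.
rewrite /psi3; notypeclasses refine (is_derive_continuous _).
by repeat derive_step; rewrite mulf_neq0// expf_neq0.
Qed.

(** Nothing is known of psi at nonpositive reals, so the iterated derivatives of
    psi and the explicit formulas agree on an open half-line only. *)
Lemma derive1_eq_pos (f g g' : K -> K) x :
  (forall t : K, 0 < t -> f t = g t) ->
  (forall t : K, 0 < t -> is_derive t 1 g (g' t)) ->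
  0 < x -> (f^`())%classic x = g' x.
Proof.
move=> fg dg x0; rewrite derive1E.
have -> : 'D_1 f x = 'D_1 g x; last by have [] := dg x x0.
apply: near_eq_derive.
by near=> t; apply: fg; near: t; exact: lt_nbhsr.
Unshelve. all: by end_near. Qed.

Lemma derive1_psi s x : 0 < x -> (psi s)^`()%classic x = psi1 s x.
Proof. by apply: derive1_eq_pos => // t; exact: is_derive_psi. Qed.

Lemma derive1n3_psi s x : 0 < x -> (psi s)^`(3)%classic x = psi3 s x.
Proof.
rewrite !derive1nS derive1n0.
apply: (derive1_eq_pos _ (is_derive_psi2 s)).
move=> t; apply: (derive1_eq_pos _ (is_derive_psi1 s)).
by move=> {}t; exact: derive1_psi.
Qed.

Lemma norm_psi3 s x : -1 <= s -> 0 < x -> `|psi3 s x| = - psi3 s x.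
Proof.
move=> s1 x0; rewrite ler0_norm// oppr_le0.
by rewrite mulr_ge0 ?powR_ge0// divr_ge0 ?mulr_ge0 ?exprn_ge0//; lra.
Qed.

(** With u = mean_ratio x, - psi3 s x is the product of 3 + (s + 1) / x,
    2 / (x + 1)^4 and u^(s + 1). For -1 <= s all three are nonnegative and
    nonincreasing, the last one because u decreases. The factor u^s would not
    do: it increases when s < 0. *)
Lemma psi3_nondecreasing s x y : -1 <= s -> 0 < x -> x <= y ->
  psi3 s x <= psi3 s y.
Proof.
move=> s1 x0 xy; have y0 : 0 < y by lra.
have E t : 0 < t -> psi3 s t =
    - ((3 + (s + 1) / t) * (2 / (t + 1) ^+ 4) * mean_ratio t `^ (s + 1)).
  move=> t0; rewrite /psi3 powRD; last first.
    by rewrite (gt_eqF (mean_ratio_gt0 t0)) implybT.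
  rewrite powRr1 ?ltW ?mean_ratio_gt0//.
  move: (mean_ratio t `^ s) => z; rewrite /mean_ratio.
  by field; rewrite !gt_eqF//; lra.
have s10 : 0 <= s + 1 by lra.
have mean_ratio_le : mean_ratio y <= mean_ratio x.
  have mean_ratioE t : 0 < t -> mean_ratio t = 2^-1 * (1 + t^-1).
    by move=> t0; rewrite /mean_ratio; field; rewrite gt_eqF.
  by rewrite !mean_ratioE// ler_wpM2l// lerD2l lef_pV2.
rewrite !E// lerN2; apply: ler_pM.
- by rewrite mulr_ge0// ?divr_ge0// ?exprn_ge0//;
    [rewrite addr_ge0// divr_ge0//|]; lra.
- exact: powR_ge0.
- apply: ler_pM.
  + by rewrite addr_ge0// divr_ge0//; lra.
  + by rewrite divr_ge0// exprn_ge0//; lra.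
  + by rewrite lerD2l ler_wpM2l// lef_pV2// posrE; lra.
  + rewrite ler_pM2l// lef_pV2// ?posrE ?exprn_gt0//; [|lra..].
    by rewrite lerXn2r// ?nnegrE; lra.
- by apply: ge0_ler_powR; rewrite // nnegrE ltW// mean_ratio_gt0.
Qed.

End psi_derivatives.

(** * The essential supremum of the third derivative *)

Section essential_supremum.
Context {K : realType}.

Lemma ae_mrestr (D : set K) (mD : measurable D) (S : K -> Prop) :
  (forall x, D x -> S x) ->
  {ae mrestr (@lebesgue_measure K) mD, forall x, S x}.
Proof.
move=> DS; exists (~` D); split; first exact: measurableC.
  by rewrite /= /mrestr setICl measure0.
by move=> x /= nSx Dx; apply: nSx; exact: DS.
Qed.

(** By continuity at r, a bound smaller than g r would fail on an interval
    [r, r + d[, whose intersection with [r, R] is not negligible. *)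
Lemma ess_sup_left_endpoint (r R : K) (g : K -> K) : r < R ->
  (forall x, r <= x <= R -> g x <= g r) -> {for r, continuous g} ->
  ess_sup (mrestr (@lebesgue_measure K) (measurable_itv `[r, R]))
    (fun x => (g x)%:E) = (g r)%:E.
Proof.
move=> rR gr cg; apply/eqP; rewrite eq_le; apply/andP; split.
  apply/ess_supP; apply: ae_mrestr => x /=.
  by rewrite in_itv/= lee_fin => /gr.
set e := ess_sup _ _; rewrite leNgt; apply/negP => egr.
have [N [mN N0 subN]] :
    {ae mrestr (@lebesgue_measure K) (measurable_itv `[r, R]), forall x,
      ((g x)%:E <= e)%E}.
  exact: ess_sup_ge.
have [d d0 eg] : exists2 d : K, 0 < d &
    forall x, r <= x < r + d -> (e < (g x)%:E)%E.
  case: e egr {subN} => [e| //|] egr; last by exists 1 => // x _; rewrite ltNyr.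
  rewrite lte_fin in egr.
  have : nbhs r (g @^-1` [set y | e < y]) by exact/cg/lt_nbhsr.
  move=> [d /= d0 rd]; exists d => // x /andP[rx xd]; rewrite lte_fin.
  by apply: rd => /=; rewrite ler0_norm ?subr_le0//; lra.
pose I : set K := `[r, Num.min R (r + d)[%classic.
have sub : I `<=` N `&` `[r, R].
  move=> x; rewrite /I/= in_itv/= lt_min => /and3P[rx xR xd]; split.
    by apply: subN => /=; apply/negP; rewrite -ltNge; apply: eg; rewrite rx.
  by rewrite in_itv/= rx ltW.
have : (@lebesgue_measure K I <= 0)%E.
  rewrite -N0 /= /mrestr; apply: le_measure => //; rewrite inE.
    exact: measurable_itv.
  by apply: measurableI.
rewrite lebesgue_measure_itv/= lte_fin lt_min rR ltrDl d0/= -EFinD lee_fin.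
by rewrite subr_le0 ge_min !leNgt rR ltrDl d0.
Qed.

End essential_supremum.

Section psi_norm.
Context {K : realType}.
Implicit Types s r R : K.

Lemma psi3_esssupE s r R : -1 <= s -> 0 < r -> r < R ->
  psi3_esssup s r R = (- psi3 s r)%:E.
Proof.
move=> s1 r0 rR; rewrite /psi3_esssup.
transitivity (ess_sup (mrestr (@lebesgue_measure K) (measurable_itv `[r, R]))
    (fun x => (- psi3 s x)%:E)).
  apply: eq_ess_sup; apply: ae_mrestr => x rxR.
  have rx : r <= x by move: rxR; rewrite /= in_itv => /andP[].
  have x0 := lt_le_trans r0 rx.
  by rewrite derive1n3_psi// norm_psi3.
apply: ess_sup_left_endpoint => //.
  by move=> x /andP[rx _]; rewrite lerN2 psi3_nondecreasing.
exact/continuousN/continuous_psi3.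
Qed.

Lemma psi3_normE s r R : -1 <= s -> 0 < r -> r < R ->
  psi3_norm s r R = - psi3 s r.
Proof. by move=> s1 r0 rR; rewrite /psi3_norm psi3_esssupE. Qed.

Lemma delta_OmegaE s r R : 0 < r -> 0 < R ->
  delta_Omega s r R = psi2 s r - psi2 s R.
Proof.
move=> r0 R0.
have E x : 0 < x ->
    4^-1 * ((x ^+ 3)^-1 * ((x + 1) / (2 * x)) `^ (s - 2)) = psi2 s x.
  move=> x0; rewrite /psi2 -/(mean_ratio x) powRB; last first.
    by rewrite (gt_eqF (mean_ratio_gt0 x0)) implybT.
  rewrite (@powR_mulrn _ _ 2) ?ltW ?mean_ratio_gt0//.
  move: (mean_ratio x `^ s) => y; rewrite /mean_ratio.
  by field; rewrite !gt_eqF//; lra.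
by rewrite /delta_Omega mulrBr !E.
Qed.

End psi_norm.

(** * Divergences as averages over the ratios p / q *)

Section csiszar.
Context {K : realType} (n : nat).
Variables (P Q : 'I_n -> K) (r R : K).
Hypotheses (hP : Gamma P) (hQ : Gamma Q).

Let P0 i : 0 < P i. Proof. by case: hP. Qed.
Let Q0 i : 0 < Q i. Proof. by case: hQ. Qed.
Let Pn0 i : P i != 0. Proof. by rewrite gt_eqF. Qed.
Let Qn0 i : Q i != 0. Proof. by rewrite gt_eqF. Qed.
Let PQn0 i : P i + Q i != 0. Proof. by rewrite gt_eqF// addr_gt0. Qed.
Let sumP : \sum_(i < n) P i = 1. Proof. by case: hP. Qed.
Let sumQ : \sum_(i < n) Q i = 1. Proof. by case: hQ. Qed.

(** This is where both P and Q having total mass 1 enters the representations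
    below: the affine terms that normalize psi sum to 0. *)
Lemma sum_eq_mod_diff (F G : 'I_n -> K) (c : K) :
  (forall i, F i = G i + c * (P i - Q i)) ->
  \sum_(i < n) F i = \sum_(i < n) G i.
Proof.
move=> FG; rewrite (eq_bigr _ (fun i _ => FG i)) big_split/= -mulr_sumr sumrB.
by rewrite sumP sumQ subrr mulr0 addr0.
Qed.

Definition moment k : K := \sum_(i < n) Q i * `|P i / Q i - 1| ^+ k.

Let ratio_dist i : `|P i / Q i - 1| = `|P i - Q i| / Q i.
Proof.
rewrite (_ : _ - 1 = (P i - Q i) / Q i); last by field.
by rewrite normrM normfV (gtr0_norm (Q0 i)).
Qed.

Lemma chi2E : chi2 P Q = moment 2.
Proof.
apply: eq_bigr => i _; rewrite ratio_dist -[(_ - _) ^+ 2]real_normK ?num_real//.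
by field.
Qed.

Lemma chi3E : chi3 P Q = moment 3.
Proof. by apply: eq_bigr => i _; rewrite ratio_dist; field. Qed.

Lemma VdistE : Vdist P Q = moment 1.
Proof. by apply: eq_bigr => i _; rewrite ratio_dist; field. Qed.

Lemma OmegaE (s : K) : Omega s P Q = \sum_(i < n) Q i * psi s (P i / Q i).
Proof.
have mean_ratioE i :
    (P i / Q i + 1) / (2 * (P i / Q i)) = (P i + Q i) / (2 * P i).
  by field; rewrite Pn0 Qn0.
rewrite /Omega /psi; case: eqVneq => [_|s0]; last case: eqVneq => [_|s1].
- apply: (@sum_eq_mod_diff _ _ (2^-1)) => i; rewrite mean_ratioE.
  have -> : 2 * P i / (P i + Q i) = ((P i + Q i) / (2 * P i))^-1.
    by rewrite invf_div.
  rewrite lnV ?posrE ?divr_gt0 ?addr_gt0 ?mulr_gt0//.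
  by move: (ln _) => l; field.
- apply: (@sum_eq_mod_diff _ _ (- 2^-1)) => i; rewrite mean_ratioE.
  by move: (ln _) => l; field.
- rewrite -[X in _ * (_ - X) = _]sumP -sumrB mulr_sumr.
  apply: (@sum_eq_mod_diff _ _ (- (2 * (s - 1))^-1)) => i; rewrite mean_ratioE.
  move: (_ `^ s) => y; field.
  by rewrite s0 Qn0 subr_eq0 s1.
Qed.

Lemma E_OmegaE (s : K) :
  E_Omega s P Q = \sum_(i < n) (P i - Q i) * psi1 s (P i / Q i).
Proof.
have mean_ratioE i : mean_ratio (P i / Q i) = (P i + Q i) / (2 * P i).
  by rewrite /mean_ratio; field; rewrite Pn0 Qn0.
rewrite /E_Omega /psi1; case: eqVneq => [_|s0]; last case: eqVneq => [_|s1].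
- rewrite /Ddiv /Delta mulr_sumr -sumrB; apply: (@sum_eq_mod_diff _ _ 0) => i.
  rewrite mean_ratioE [Q i + P i]addrC; move: (ln _) => l; field.
  by rewrite PQn0 Qn0.
- rewrite /Ddiv /chi2 -sumrB mulr_sumr.
  apply: (@sum_eq_mod_diff _ _ 0) => i.
  rewrite mean_ratioE [Q i + P i]addrC; move: (ln _) => l; field.
  by rewrite Pn0 Qn0.
- rewrite mulr_sumr.
  apply: (@sum_eq_mod_diff _ _ ((1 - s / 2) / (s * (s - 1)))) => i.
  rewrite mean_ratioE; move: (_ `^ s) => y; field.
  by rewrite s0 Qn0 PQn0 subr_eq0 s1.
Qed.

Lemma Estar_OmegaE (s : K) : Estar_Omega s P Q =
  \sum_(i < n) (P i - Q i) * psi1 s ((1 + P i / Q i) / 2).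
Proof.
have mean_ratioE i :
    mean_ratio ((1 + P i / Q i) / 2) = (P i + 3 * Q i) / (2 * (P i + Q i)).
  rewrite /mean_ratio; field.
  by rewrite !gt_eqF//; have := Q0 i; have := P0 i; lra.
rewrite /Estar_Omega /psi1; case: eqVneq => [_|s0]; last case: eqVneq => [_|s1].
- rewrite mulr_sumr -sumrB; apply: (@sum_eq_mod_diff _ _ 0) => i.
  rewrite mean_ratioE; move: (ln _) => l; field.
  by rewrite !gt_eqF//; have := Q0 i; have := P0 i; lra.
- rewrite /Delta !mulr_sumr -big_split/=.
  apply: (@sum_eq_mod_diff _ _ 0) => i.
  rewrite mean_ratioE; move: (ln _) => l; field.
  by rewrite !gt_eqF//; have := Q0 i; have := P0 i; lra.
- rewrite mulr_sumr.
  apply: (@sum_eq_mod_diff _ _ ((1 - s / 2) / (s * (s - 1)))) => i.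
  rewrite mean_ratioE; move: (_ `^ s) => y; field.
  rewrite s0 subr_eq0 s1 !gt_eqF//; have := Q0 i; have := P0 i; lra.
Qed.

Hypothesis hPQ : forall i : 'I_n, r <= P i / Q i <= R.

Lemma norm_sum_le_moment (F : 'I_n -> K) (e : K -> K) (C : K) k :
  (forall i, F i = Q i * e (P i / Q i)) ->
  (forall x, r <= x <= R -> `|e x| <= C * `|x - 1| ^+ k) ->
  `|\sum_(i < n) F i| <= C * moment k.
Proof.
move=> Fe eC; rewrite (le_trans (ler_norm_sum _ _ _))// mulr_sumr.
apply: ler_sum => i _; rewrite Fe normrM (gtr0_norm (Q0 i)) mulrCA.
by rewrite ler_wpM2l ?eC// ltW.
Qed.

Hypotheses (r1 : r < 1) (R1 : 1 < R).

(* Convexity of |x - 1|^(k+1) on [r, R]. On the side of 1 where x lies, with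
   y = |x - 1| and a the value of y at the endpoint, it reduces to
   y^k <= a^k. *)
Let chord x k : r <= x <= R ->
  (R - r) * `|x - 1| ^+ k.+1 <=
  (R - x) * (1 - r) ^+ k.+1 + (x - r) * (R - 1) ^+ k.+1.
Proof.
move=> /andP[rx xR].
have a0 : 0 <= 1 - r by rewrite subr_ge0 ltW.
have b0 : 0 <= R - 1 by rewrite subr_ge0 ltW.
have key (a b y : K) : 0 <= a -> 0 <= b -> 0 <= y -> y <= a ->
    (a + b) * y ^+ k.+1 <= (b + y) * a ^+ k.+1 + (a - y) * b ^+ k.+1.
  move=> {}a0 {}b0 y0 ya; have yak : y ^+ k <= a ^+ k by rewrite lerXn2r.
  have h1 : (a + b) * y * y ^+ k <= (b + y) * a * a ^+ k.
    apply: ler_pM; rewrite ?mulr_ge0 ?exprn_ge0 ?addr_ge0//.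
    by have : 0 <= (a - y) * b by [rewrite mulr_ge0// subr_ge0]; lra.
  have h2 : 0 <= (a - y) * b ^+ k.+1 by rewrite mulr_ge0 ?exprn_ge0 ?subr_ge0.
  by move: h1; rewrite -!mulrA -!exprS; lra.
have [x1|x1] := leP x 1.
  rewrite ler0_norm ?subr_le0// opprB.
  have := key (1 - r) (R - 1) (1 - x).
  rewrite (_ : 1 - r + (R - 1) = R - r); last by ring.
  rewrite (_ : R - 1 + (1 - x) = R - x); last by ring.
  rewrite (_ : 1 - r - (1 - x) = x - r); last by ring.
  by apply; rewrite // ?subr_ge0// lerD2l lerN2.
rewrite gtr0_norm ?subr_gt0//.
have := key (R - 1) (1 - r) (x - 1).
rewrite (_ : R - 1 + (1 - r) = R - r); last by ring.
rewrite (_ : 1 - r + (x - 1) = x - r); last by ring.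
rewrite (_ : R - 1 - (x - 1) = R - x); last by ring.
by move=> h; rewrite [leRHS]addrC; apply: h; rewrite ?lerD2r// subr_ge0 ltW.
Qed.

(** The chord of |x - 1|^(k+1) is affine in x, so its average only depends on
    the average of the ratios, which is 1. *)
Lemma moment_le_chord k : (R - r) * moment k.+1 <=
  (R - 1) * (1 - r) ^+ k.+1 + (1 - r) * (R - 1) ^+ k.+1.
Proof.
rewrite mulr_sumr.
have -> : (R - 1) * (1 - r) ^+ k.+1 + (1 - r) * (R - 1) ^+ k.+1 =
    \sum_(i < n) Q i * ((R - P i / Q i) * (1 - r) ^+ k.+1 +
                       (P i / Q i - r) * (R - 1) ^+ k.+1).
  rewrite (eq_bigr (fun i => (R * Q i - P i) * (1 - r) ^+ k.+1 +
     (P i - r * Q i) * (R - 1) ^+ k.+1)); last first.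
    by move=> i _; field.
  rewrite big_split/= -!mulr_suml !sumrB -!mulr_sumr sumP sumQ.
  by rewrite !mulr1.
apply: ler_sum => i _; rewrite mulrCA ler_wpM2l ?chord//.
exact: ltW.
Qed.

Let rR : 0 < R - r. Proof. by rewrite subr_gt0 (lt_trans r1 R1). Qed.

Lemma Vdist_le : Vdist P Q <= (R - r) / 2.
Proof.
rewrite VdistE -(ler_pM2l rR) (le_trans (moment_le_chord 0))// !expr1.
by have := sqr_ge0 ((R - 1) - (1 - r)); lra.
Qed.

Lemma chi2_le : chi2 P Q <= (R - r) ^+ 2 / 4.
Proof.
rewrite chi2E -(ler_pM2l rR) (le_trans (moment_le_chord 1))//.
rewrite (_ : _ + _ = (R - r) * ((R - 1) * (1 - r))); last by ring.
rewrite ler_pM2l//.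
by have := sqr_ge0 ((R - 1) - (1 - r)); lra.
Qed.

(** With a = 1 - r and b = R - 1, the gap is a multiple of
    (a + b)^4 - 8 a b (a^2 + b^2) = (a - b)^4. *)
Lemma chi3_le : chi3 P Q <= (R - r) ^+ 3 / 8.
Proof.
rewrite chi3E -(ler_pM2l rR) (le_trans (moment_le_chord 2))//.
rewrite -subr_ge0.
rewrite (_ : _ - _ = (((R - 1) - (1 - r)) ^+ 2) ^+ 2 / 8); last by field.
by rewrite divr_ge0// sqr_ge0.
Qed.

End csiszar.

(** * Quadrature errors of psi *)

Section psi_errors.
Context {K : realType}.
Variables s r R : K.
Hypotheses (s1 : -1 <= s) (r0 : 0 < r) (r1 : r < 1) (R1 : 1 < R).

Let pos t : r <= t -> 0 < t. Proof. exact: lt_le_trans. Qed.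

Let dpsi t : r <= t <= R -> is_derive t 1 (psi s) (psi1 s t).
Proof. by move=> /andP[/pos t0 _]; exact: is_derive_psi. Qed.

Let dpsi1 t : r <= t <= R -> is_derive t 1 (psi1 s) (psi2 s t).
Proof. by move=> /andP[/pos t0 _]; exact: is_derive_psi1. Qed.

Let one_in : r <= 1 <= R. Proof. by rewrite !ltW. Qed.

Lemma psi2_ge0 t : 0 < t -> 0 <= psi2 s t.
Proof.
move=> /ltW t0.
by rewrite /psi2 divr_ge0 ?powR_ge0// mulr_ge0 ?exprn_ge0 ?addr_ge0.
Qed.

Lemma psi3_le0 t : 0 < t -> psi3 s t <= 0.
Proof. by move=> t0; rewrite -oppr_ge0 -norm_psi3. Qed.

Lemma psi1_ndecr u v : r <= u -> u <= v -> v <= R -> psi1 s u <= psi1 s v.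
Proof.
move=> ru uv vR; rewrite -subr_ge0.
have [|c /andP[uc cv] ->] := @mean_value _ (psi1 s) (psi2 s) u v uv.
  by move=> t /andP[ut _]; exact/is_derive_psi1/pos/(le_trans ru).
by rewrite mulr_ge0 ?subr_ge0// psi2_ge0// pos// (le_trans ru).
Qed.

Lemma psi2_nincr u v : r <= u -> u <= v -> v <= R -> psi2 s v <= psi2 s u.
Proof.
move=> ru uv vR; rewrite -subr_le0.
have [|c /andP[uc cv] ->] := @mean_value _ (psi2 s) (psi3 s) u v uv.
  by move=> t /andP[ut _]; exact/is_derive_psi2/pos/(le_trans ru).
by rewrite mulr_le0_ge0 ?subr_ge0// psi3_le0// pos// (le_trans ru).
Qed.

Lemma psi2_oscillation u v : r <= u -> u <= v -> v <= R ->
  `|psi2 s v - psi2 s u| <= (psi2 s r - psi2 s R) * (v - u) ^+ 0.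
Proof.
move=> ru uv vR; rewrite expr0 mulr1 ler0_norm ?subr_le0 ?psi2_nincr// opprB.
by rewrite lerB// psi2_nincr// ?(le_trans uv)// (le_trans ru).
Qed.

Lemma psi2_lipschitz u v : r <= u -> u <= v -> v <= R ->
  `|psi2 s v - psi2 s u| <= - psi3 s r * (v - u) ^+ 1.
Proof.
move=> ru uv vR.
have [|c /andP[uc cv] ->] := @mean_value _ (psi2 s) (psi3 s) u v uv.
  by move=> t /andP[ut _]; exact/is_derive_psi2/pos/(le_trans ru).
have rc : r <= c by rewrite (le_trans ru).
rewrite expr1 normrM (ger0_norm (_ : 0 <= v - u)) ?subr_ge0//.
by rewrite ler_wpM2r ?subr_ge0// norm_psi3 ?pos// lerN2 psi3_nondecreasing.
Qed.

Lemma psi_at1 : psi s 1 = 0.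
Proof.
rewrite /psi (_ : (1 + 1) / (2 * 1) = 1 :> K); last by field.
rewrite ln1 powR1/= !(subrr, mul0r, mulr0, mul1r, addr0, subr0).
by case: ifP => // _; case: ifP.
Qed.

Lemma psi1_at1 : psi1 s 1 = 0.
Proof.
rewrite /psi1 /mean_ratio (_ : (1 + 1) / (2 * 1) = 1 :> K); last by field.
rewrite ln1 powR1/=; case: eqVneq => [_|s0]; last case: eqVneq => [_|s1'].
- by field.
- by field.
- by field; rewrite s0 subr_eq0 s1'.
Qed.

(** The errors of the two rules on [1, x], simplified by psi s 1 = 0 and
    psi1 s 1 = 0. *)
Definition trapezoid_defect x := psi s x - 2^-1 * (x - 1) * psi1 s x.

Definition midpoint_defect x := psi s x - (x - 1) * psi1 s ((1 + x) / 2).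

Let trapezoidE x : trapezoid_defect x =
  psi s x - psi s 1 - (x - 1) * ((psi1 s 1 + psi1 s x) / 2).
Proof. by rewrite psi_at1 psi1_at1 /trapezoid_defect; ring. Qed.

Let midpointE x : midpoint_defect x =
  psi s x - psi s 1 - (x - 1) * psi1 s ((1 + x) / 2).
Proof. by rewrite psi_at1 /midpoint_defect subr0. Qed.

Variable x : K.
Hypothesis xrR : r <= x <= R.

Lemma trapezoid_defect_delta :
  `|trapezoid_defect x| <= 8^-1 * (psi2 s r - psi2 s R) * `|x - 1| ^+ 2.
Proof.
rewrite trapezoidE.
rewrite (_ : 8^-1 * _ = (psi2 s r - psi2 s R) / (4 * 2)); last by field.
exact: (trapezoid_rule dpsi dpsi1 psi2_oscillation one_in xrR).
Qed.

Lemma trapezoid_defect_psi3 :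
  `|trapezoid_defect x| <= 12^-1 * - psi3 s r * `|x - 1| ^+ 3.
Proof.
rewrite trapezoidE (_ : 12^-1 * _ = - psi3 s r / (4 * 3)); last by field.
exact: (trapezoid_rule dpsi dpsi1 psi2_lipschitz one_in xrR).
Qed.

Lemma trapezoid_defect_psi1 :
  `|trapezoid_defect x| <= 2^-1 * (psi1 s R - psi1 s r) * `|x - 1| ^+ 1.
Proof.
by rewrite trapezoidE; exact: (trapezoid_rule_ndecr dpsi psi1_ndecr one_in xrR).
Qed.

Lemma midpoint_defect_delta :
  `|midpoint_defect x| <= 8^-1 * (psi2 s r - psi2 s R) * `|x - 1| ^+ 2.
Proof.
rewrite midpointE.
rewrite (_ : 8^-1 * _ = (psi2 s r - psi2 s R) / (4 * 1 * 2)); last by field.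
exact: (midpoint_rule dpsi dpsi1 psi2_oscillation one_in xrR).
Qed.

Lemma midpoint_defect_psi3 :
  `|midpoint_defect x| <= 24^-1 * - psi3 s r * `|x - 1| ^+ 3.
Proof.
rewrite midpointE (_ : 24^-1 * _ = - psi3 s r / (4 * 2 * 3)); last by field.
exact: (midpoint_rule dpsi dpsi1 psi2_lipschitz one_in xrR).
Qed.

Lemma midpoint_defect_psi1 :
  `|midpoint_defect x| <= 2^-1 * (psi1 s R - psi1 s r) * `|x - 1| ^+ 1.
Proof.
by rewrite midpointE; exact: (midpoint_rule_ndecr dpsi psi1_ndecr one_in xrR).
Qed.

End psi_errors.

(** * The inequalities between divergences *)

Lemma le_min3 (K : realType) (a b c a' b' c' : K) :
  a <= a' -> b <= b' -> c <= c' -> min3 a b c <= min3 a' b' c'.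
Proof.
move=> aa bb cc; rewrite /min3 !le_min !ge_min aa bb cc !orbT.
by [].
Qed.

Theorem theorem5 (K : realType) (n : nat) (hn : (2 <= n)%N)
    (P Q : 'I_n -> K) (hP : Gamma P) (hQ : Gamma Q)
    (r R : K) (hr0 : 0 < r) (hr1 : r < 1) (hR1 : 1 < R)
    (hPQ : forall i : 'I_n, r <= P i / Q i <= R)
    (s : K) (hs : -1 <= s) :
  [/\ `|Omega s P Q - 2^-1 * E_Omega s P Q|
        <= min3 (8^-1 * delta_Omega s r R * chi2 P Q)
                (12^-1 * psi3_norm s r R * chi3 P Q)
                (((psi s)^`()%classic R - (psi s)^`()%classic r) * Vdist P Q),
      min3 (8^-1 * delta_Omega s r R * chi2 P Q)
           (12^-1 * psi3_norm s r R * chi3 P Q)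
           (((psi s)^`()%classic R - (psi s)^`()%classic r) * Vdist P Q)
        <= min3 ((R - r) ^+ 2 / 32 * delta_Omega s r R)
                ((R - r) ^+ 3 / 96 * psi3_norm s r R)
                ((R - r) / 2 * ((psi s)^`()%classic R - (psi s)^`()%classic r)),
      `|Omega s P Q - Estar_Omega s P Q|
        <= min3 (8^-1 * delta_Omega s r R * chi2 P Q)
                (24^-1 * psi3_norm s r R * chi3 P Q)
                (2^-1 * ((psi s)^`()%classic R - (psi s)^`()%classic r) * Vdist P Q),
      min3 (8^-1 * delta_Omega s r R * chi2 P Q)
           (24^-1 * psi3_norm s r R * chi3 P Q)
           (2^-1 * ((psi s)^`()%classic R - (psi s)^`()%classic r) * Vdist P Q)
        <= min3 ((R - r) ^+ 2 / 32 * delta_Omega s r R)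
                ((R - r) ^+ 3 / 192 * psi3_norm s r R)
                ((R - r) / 4 * ((psi s)^`()%classic R - (psi s)^`()%classic r))
    & psi3_esssup s r R
        = ((s + 1 + 3 * r) / (r ^+ 2 * (r + 1) ^+ 3)
             * ((r + 1) / (2 * r)) `^ s)%:E ].
Proof.
have rR : r < R := lt_trans hr1 hR1.
have R0 : 0 < R := lt_trans hr0 rR.
rewrite delta_OmegaE// psi3_normE// !derive1_psi//.
have D0 : 0 <= psi2 s r - psi2 s R.
  by rewrite subr_ge0; exact: (psi2_nincr hs hr0 (lexx r) (ltW rR) (lexx R)).
have M0 : 0 <= - psi3 s r by rewrite -norm_psi3.
have L0 : 0 <= psi1 s R - psi1 s r.
  by rewrite subr_ge0; exact: (psi1_ndecr s hr0 (lexx r) (ltW rR) (lexx R)).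
have X2 := chi2_le hP hQ hPQ hr1 hR1.
have X3 := chi3_le hP hQ hPQ hr1 hR1.
have V1 := Vdist_le hP hQ hPQ hr1 hR1.
have V0 : 0 <= Vdist P Q by apply: sumr_ge0.
have Q0 i : Q i != 0 by case: hQ => /(_ i) ? _; rewrite gt_eqF.
have trapE : Omega s P Q - 2^-1 * E_Omega s P Q =
    \sum_(i < n) Q i * trapezoid_defect s (P i / Q i).
  rewrite OmegaE// E_OmegaE// mulr_sumr -sumrB; apply: eq_bigr => i _.
  by rewrite /trapezoid_defect; field.
have midE : Omega s P Q - Estar_Omega s P Q =
    \sum_(i < n) Q i * midpoint_defect s (P i / Q i).
  rewrite OmegaE// Estar_OmegaE// -sumrB; apply: eq_bigr => i _.
  rewrite /midpoint_defect; move: (psi1 s _) (psi s _) => y z.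
  by field.
split; last by rewrite psi3_esssupE// /psi3 opprK.
- rewrite trapE /min3 !le_min; apply/and3P; split.
  + rewrite chi2E//; apply: (norm_sum_le_moment hQ hPQ) => // x.
    exact: trapezoid_defect_delta.
  + rewrite chi3E//; apply: (norm_sum_le_moment hQ hPQ) => // x.
    exact: trapezoid_defect_psi3.
  + apply: (@le_trans _ _ (2^-1 * (psi1 s R - psi1 s r) * Vdist P Q)).
      rewrite VdistE//; apply: (norm_sum_le_moment hQ hPQ) => // x.
      exact: trapezoid_defect_psi1.
    (* The error of the trapezoid rule leaves a factor 2 to spare. *)
    by rewrite ler_wpM2r//; lra.
- apply: le_min3.
  + by have := ler_wpM2l D0 X2; lra.
  + by have := ler_wpM2l M0 X3; lra.
  + by have := ler_wpM2l L0 V1; lra.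
- rewrite midE /min3 !le_min; apply/and3P; split.
  + rewrite chi2E//; apply: (norm_sum_le_moment hQ hPQ) => // x.
    exact: midpoint_defect_delta.
  + rewrite chi3E//; apply: (norm_sum_le_moment hQ hPQ) => // x.
    exact: midpoint_defect_psi3.
  + rewrite VdistE//; apply: (norm_sum_le_moment hQ hPQ) => // x.
    exact: midpoint_defect_psi1.
- apply: le_min3.
  + by have := ler_wpM2l D0 X2; lra.
  + by have := ler_wpM2l M0 X3; lra.
  + by have := ler_wpM2l L0 V1; lra.
Qed.
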